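(* Let $A$ be a finitely generated abelian group that is circularly orderable. Then $\operatorname{Aut}(A)$ acts faithfully on the set $\mathrm{CO}_g(A)$ of genuine circular orders on $A$.
   Context: A left-invariant circular order on a group $G$ is a map $\phi:G^3\to\{-1,0,1\}$ such that: (DV) $\phi(x,y,z)=0$ if and only if at least two of $x,y,z$ are equal; (C) $\phi(g_1,g_2,g_3)-\phi(g_0,g_2,g_3)+\phi(g_0,g_1,g_3)-\phi(g_0,g_1,g_2)=0$ for all $g_0,\dots,g_3\in G$; (H) $\phi(gg_0,gg_1,gg_2)=\phi(g_0,g_1,g_2)$ for all $g,g_0,g_1,g_2\in G$. $\mathrm{CO}(G)$ is the set of all left-invariant circular orders on $G$; $G$ is circularly orderable if $\mathrm{CO}(G)\neq\emptyset$. Each left-invariant linear order $<$ on $G$ (a total order with $a<b\Rightarrow ga<gb$) gives an element $c_<\in\mathrm{CO}(G)$: $c_<(x,y,z)=+1$ if $x<y<z$, $y<z<x$ or $z<x<y$; $c_<(x,y,z)=-1$ if $x<z<y$, $y<x<z$ or $z<y<x$; and $c_<(x,y,z)=0$ otherwise. A circular order is genuine if it is not of the form $c_<$; $\mathrm{CO}_g(G)\subset\mathrm{CO}(G)$ denotes the set of genuine circular orders. The group $\operatorname{Aut}(G)$ acts on $\mathrm{CO}(G)$ by $(\rho\cdot\phi)(g_0,g_1,g_2)=\phi(\rho^{-1}(g_0),\rho^{-1}(g_1),\rho^{-1}(g_2))$, and this action preserves $\mathrm{CO}_g(G)$. *)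

(* Defs.v *)
From HB Require Import structures.
From mathcomp Require Import all_boot all_algebra.
From mathcomp Require Import boolp classical_sets.

Set Implicit Arguments.
Unset Strict Implicit.
Unset Printing Implicit Defensive.

Import GRing.Theory.

Local Open Scope classical_set_scope.
Local Open Scope group_scope.

Section Groups.
Variable G : groupType.

(* The subgroup generated by [s], i.e. the least subgroup containing it, is [G]. *)
Definition finitely_generated : Prop :=
  exists s : seq G, forall H : {pred G},
    group_closed H -> {subset s <= H} -> forall x, x \in H.

Definition abelian_group : Prop := forall x y : G, commute x y.

(* [perm] and [Aut] only cover finite groups; [autom G] is Aut(G) for any [G],
   a [groupType] under composition, (r * s) x = r (s x). *)
Record autom := Autom {
  autom_fun :> G -> G;
  autom_inv : G -> G;
  automM : {morph autom_fun : x y / x * y};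
  automK : cancel autom_fun autom_inv;
  automVK : cancel autom_inv autom_fun }.

Lemma autom_eq (r s : autom) : autom_fun r =1 autom_fun s -> r = s.
Proof.
case: r s => [f f' fM fK f'K] [g g' gM gK g'K] /= fg.
have {}fg : f = g by apply/funext.
subst g.
have fg' : f' = g' by apply/funext => x; rewrite -{1}(g'K x) fK.
subst g'.
by rewrite (Prop_irrelevance fM gM) (Prop_irrelevance fK gK)
  (Prop_irrelevance f'K g'K).
Qed.

HB.instance Definition _ := gen_eqMixin autom.
HB.instance Definition _ := gen_choiceMixin autom.

Definition autom_one : autom :=
  @Autom id id (fun _ _ => erefl) (fun _ => erefl) (fun _ => erefl).

Lemma autom_mul_morph (r s : autom) : {morph r \o s : x y / x * y}.
Proof. by move=> x y /=; rewrite !automM. Qed.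

Definition autom_mul (r s : autom) : autom :=
  @Autom (r \o s) (autom_inv s \o autom_inv r) (autom_mul_morph r s)
    (can_comp (@automK r) (@automK s)) (can_comp (@automVK s) (@automVK r)).

Lemma autom_inv_morph (r : autom) : {morph autom_inv r : x y / x * y}.
Proof. by move=> x y; apply: (can_inj (@automK r)); rewrite automM !automVK. Qed.

Definition autom_V (r : autom) : autom :=
  @Autom (autom_inv r) r (autom_inv_morph r) (@automVK r) (@automK r).

Lemma autom_mulA : associative autom_mul.
Proof. by move=> r s t; apply: autom_eq. Qed.

Lemma autom_mul1 : left_id autom_one autom_mul.
Proof. by move=> r; apply: autom_eq. Qed.

Lemma autom_1mul : right_id autom_one autom_mul.
Proof. by move=> r; apply: autom_eq. Qed.

Lemma autom_mulVr : left_inverse autom_one autom_V autom_mul.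
Proof. by move=> r; apply: autom_eq => x /=; rewrite automK. Qed.

Lemma autom_mulrV : right_inverse autom_one autom_V autom_mul.
Proof. by move=> r; apply: autom_eq => x /=; rewrite automVK. Qed.

HB.instance Definition _ := isGroup.Build autom
  autom_mulA autom_mul1 autom_1mul autom_mulVr autom_mulrV.

End Groups.

Section Actions.
Variables (H : groupType) (T : Type) (to : H -> T -> T) (S : set T).

Definition acts_on : Prop :=
  [/\ forall g x, S x -> S (to g x),
      forall x, S x -> to 1 x = x
    & forall g h x, S x -> to (g * h) x = to g (to h x)].

Definition acts_faithfully_on : Prop :=
  acts_on /\ forall g, (forall x, S x -> to g x = x) -> g = 1.

End Actions.

Section CircularOrders.
Variable G : groupType.
Implicit Types (phi : G -> G -> G -> int) (lt : rel G).

Record circular_order phi : Prop := CircularOrder {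
  co_range : forall x y z, phi x y z \in [:: -1; 0; 1]%R;
  co_DV : forall x y z, phi x y z = 0%R <-> [\/ x = y, y = z | x = z];
  co_C : forall g0 g1 g2 g3,
    (phi g1 g2 g3 - phi g0 g2 g3 + phi g0 g1 g3 - phi g0 g1 g2 = 0)%R;
  co_H : forall g g0 g1 g2, phi (g * g0) (g * g1) (g * g2) = phi g0 g1 g2 }.

(* [lt] is the strict part of the order. *)
Record left_linear_order lt : Prop := LeftLinearOrder {
  lo_irr : irreflexive lt;
  lo_trans : transitive lt;
  lo_total : forall x y, x != y -> lt x y || lt y x;
  lo_left : forall g a b, lt a b -> lt (g * a) (g * b) }.

Definition circular_of_linear lt (x y z : G) : int :=
  if [|| lt x y && lt y z, lt y z && lt z x | lt z x && lt x y] then 1%R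
  else if [|| lt x z && lt z y, lt y x && lt x z | lt z y && lt y x]
       then (-1)%R
  else 0%R.

Definition CO : set (G -> G -> G -> int) := [set phi | circular_order phi].

Definition circularly_orderable : Prop := CO !=set0.

Definition genuine phi : Prop :=
  ~ exists2 lt, left_linear_order lt & phi = circular_of_linear lt.

Definition COg : set (G -> G -> G -> int) :=
  [set phi | CO phi /\ genuine phi].

(* [rho^-1] is the inverse in the group [autom G]. *)
Definition autom_act (rho : autom G) phi : G -> G -> G -> int :=
  fun g0 g1 g2 => phi (rho^-1 g0) (rho^-1 g1) (rho^-1 g2).

Lemma autom_act_CO rho phi : CO phi -> CO (autom_act rho phi).
Proof.
have inj : injective (rho^-1 : autom G) by apply: can_inj (@automVK _ rho).
case=> R D C L; split=> [x y z|x y z|g0 g1 g2 g3|g g0 g1 g2]; rewrite /autom_act.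
- exact: R.
- rewrite D; split.
    case=> e; [exact/Or31/inj|exact/Or32/inj|exact/Or33/inj].
  by case=> ->; [exact: Or31|exact: Or32|exact: Or33].
- exact: C.
- by rewrite !automM L.
Qed.

Lemma autom_act_genuine rho phi : genuine phi -> genuine (autom_act rho phi).
Proof.
move=> gphi [lt [I T O L] E]; apply: gphi.
exists (fun x y => lt (rho x) (rho y)).
  split=> [x|y x z|x y xy|g a b ab]; first exact: I.
  - exact: T.
  - by apply: O; rewrite (can_eq (@automK _ rho)).
  - by rewrite !automM; apply: L.
apply/funext => x; apply/funext => y; apply/funext => z.
have /(congr1 (fun f => f (rho x) (rho y) (rho z))) := E.
have K u : rho^-1 (rho u) = u by apply: automK.
by rewrite /autom_act !K.
Qed.

Lemma autom_acts_on_COg : acts_on autom_act COg.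
Proof.
split=> // rho phi [cphi gphi].
by split; [apply: autom_act_CO | apply: autom_act_genuine].
Qed.

End CircularOrders.

(* Main.v *)
(* A homomorphism f : A -> Q/Z whose kernel is torsion-free, lifted to [0, 1),
   and a cone in that kernel give a strict total order on A: compare f first,
   then use the cone.  This order is not invariant, but the circular order it
   induces is.  Conversely that circular order determines f: it is the coboundary
   of a bounded function built from f, and a bounded homomorphism to Q is zero.
   Hence the circular order is genuine as soon as f is nonzero, and f o rho = f
   for each automorphism rho fixing it.  If rho a <> a, it thus suffices to find
   such an f that does not vanish at b = a^-1 * rho a.

   On the torsion subgroup, the rotation number of a given circular order phi is an
   injective homomorphism to Q/Z: the bounded rational cocycle -phi(0, x, x + y)/2
   is the coboundary of its averages over cyclic subgroups.  If b is not torsion,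
   send it to 1/2.  Since Q/Z is divisible, the resulting homomorphism extends
   to A. *)
Require Import Defs.
From HB Require Import structures.
From mathcomp Require Import all_boot all_order all_algebra.
From mathcomp Require Import zify ring lra.
From mathcomp Require Import boolp classical_sets.

Set Implicit Arguments.
Unset Strict Implicit.
Unset Printing Implicit Defensive.

Import Order.TTheory GRing.Theory Num.Theory.

Local Open Scope classical_set_scope.
Local Open Scope ring_scope.

(** * Zorn's lemma above a given set *)

Lemma Zorn_bigcup_above (T : Type) (P : set (set T)) (A0 : set T) :
  P A0 ->
  (forall F : set (set T), F !=set0 -> F `<=` P -> total_on F subset ->
     P (\bigcup_(X in F) X)) ->
  exists A, [/\ A0 `<=` A, P A & forall B, A `<=` B -> P B -> B `<=` A].
Proof.
move=> PA0 chainP.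
(* Joining [A0] to every member makes the empty chain harmless: its union becomes [A0]. *)
have [F FQ totF|A [QA maxA]] := @Zorn_bigcup T [set B | P (A0 `|` B)].
  have [[X0 FX0]|F0] := pselect (F !=set0); last first.
    suff -> : \bigcup_(X in F) X = set0 by rewrite /= setU0.
    by rewrite -subset0 => x [X FX _]; apply: F0; exists X.
  rewrite /=; have -> : A0 `|` \bigcup_(X in F) X =
            \bigcup_(X in [set A0 `|` X | X in F]) X.
    rewrite bigcup_image; apply/seteqP; split=> [x [Ax|[X FX Xx]]|x [X FX [Ax|Xx]]].
    - by exists X0 => //; left.
    - by exists X => //; right.
    - by left.
    - by right; exists X.
  apply: chainP.
  - by exists (A0 `|` X0); exists X0.
  - by move=> _ [X FX <-]; apply: FQ.
  - move=> _ _ [X FX <-] [Y FY <-].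
    by have [XY|YX] := totF _ _ FX FY; [left|right]; apply: setUS.
exists (A0 `|` A); split=> // B AB PB x Bx.
apply: contrapT => nx; apply: (maxA B).
  split; first by apply: subset_trans AB.
  by move=> BA; apply: nx; right; apply: BA.
by rewrite /= (_ : A0 `|` B = B) //; apply/setUidPr => y Ay; apply: AB; left.
Qed.

(** * Extension of homomorphisms to Q/Z *)

Section CircleGraph.
Variable V : zmodType.
Implicit Types (x y : V) (q r : rat) (S : set (V * rat)).

(* Graph of a homomorphism from a subgroup of [V] to Q/Z, with each value
   represented by some of its lifts to Q. *)
Definition circle_graph S : Prop :=
  [/\ S 0, forall u v, S u -> S v -> S (u - v)
    & forall q, S (0, q) -> q \is a Num.int].

Lemma pairMz x r (k : int) : (x, r) *~ k = (x *~ k, r *~ k).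
Proof. by rewrite [LHS]surjective_pairing !raddfMz. Qed.

Lemma circle_graphMz S u (k : int) : circle_graph S -> S u -> S (u *~ k).
Proof.
case=> S0 SB _ Su.
have SN v : S v -> S (- v) by move=> Sv; rewrite -sub0r; apply: SB.
have SMn n : S (u *+ n).
  elim: n => [|n IH]; first by rewrite mulr0n.
  by rewrite mulrSr -[X in _ + X]opprK; apply/SB/SN.
by case: k => n; [apply: SMn | apply/SN/SMn].
Qed.

(** Compatibility on the multiples of [x] already in the domain keeps the sum of [S] and the cyclic
    group of [(x, r)] single-valued modulo Z. *)
Lemma circle_graph_adjoin S x r : circle_graph S ->
  (forall (k : int) q, S (x *~ k, q) -> q - r *~ k \is a Num.int) ->
  exists S', [/\ S `<=` S', S' (x, r) & circle_graph S'].
Proof.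
move=> [S0 SB Sint] xr.
exists [set u | exists k : int, S (u - (x, r) *~ k)]; split.
- by move=> u Su; exists 0; rewrite mulr0z subr0.
- by exists 1; rewrite mulr1z subrr.
split.
- by exists 0; rewrite mulr0z subr0.
- move=> u v [k Su] [l Sv]; exists (k - l); rewrite mulrzBr.
  have -> : u - v - ((x, r) *~ k - (x, r) *~ l) =
            u - (x, r) *~ k - (v - (x, r) *~ l); last exact: SB.
  by rewrite !opprB addrACA [RHS]addrACA; congr (_ + _); rewrite addrC.
- move=> q [k]; have -> : (0, q) - (x, r) *~ k = (- (x *~ k), q - r *~ k).
    by rewrite pairMz -[- (x *~ k)]add0r.
  by rewrite -mulrNz => /xr; rewrite mulrNz opprK subrK.
Qed.

Lemma circle_graph_bigcup (F : set (set (V * rat))) :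
  F !=set0 -> F `<=` circle_graph -> total_on F subset ->
  circle_graph (\bigcup_(X in F) X).
Proof.
move=> [X0 FX0] FG totF; split.
- by exists X0 => //; have [] := FG _ FX0.
- move=> u v [X FX Xu] [Y FY Yv].
  have [_ XB _] := FG _ FX; have [_ YB _] := FG _ FY.
  have [XY|YX] := totF _ _ FX FY.
    by exists Y => //; apply: YB => //; apply: XY.
  by exists X => //; apply: XB => //; apply: YX.
- by move=> q [X FX]; have [_ _] := FG _ FX; apply.
Qed.

(** Baer's argument: as Q/Z is divisible, any [x] can be adjoined to a maximal graph, which is
    therefore total. *)
Lemma circle_graph_total S : circle_graph S ->
  exists S', [/\ S `<=` S', circle_graph S' & forall x, exists r, S' (x, r)].
Proof.
move=> GS; have [S' [SS' GS' maxS']] := Zorn_bigcup_above GS circle_graph_bigcup.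
exists S'; split=> // x.
suff [r xr] : exists r, forall (k : int) q,
    S' (x *~ k, q) -> q - r *~ k \is a Num.int.
  have [S2 [S'S2 xrS2 GS2]] := circle_graph_adjoin GS' xr.
  by exists r; apply: maxS' xrS2.
have [_ SB Sint] := GS'.
pose D n := (0 < n)%N && `[< exists q, S' (x *+ n, q) >].
have [exD|noD] := pselect (exists n, D n); last first.
  exists 0 => k q Skq; have k0 : k = 0.
    apply: contrapT => /eqP k0; apply: noD; exists `|k|%N.
    rewrite /D absz_gt0 k0 /=; apply/asboolP.
    exists (q *~ sgz k); have := circle_graphMz (sgz k) GS' Skq.
    by rewrite pairMz -mulrzA [k * _]mulrC -abszEsg.
  by rewrite mul0rz subr0; apply: Sint; rewrite -(mulr0z x) -k0.
have [n /andP[n0 /asboolP[q0 Sq0]] minn] := ex_minnP exD.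
(* This value is right at [x *+ n], and minimality forces [n] to divide each [k] with [x *~ k] in
   the domain, so no other constraint arises. *)
exists (q0 / n%:R) => k q Skq.
have Sr : S' (x *~ k - x *~ n *~ (k %/ n)%Z, q - q0 *~ (k %/ n)%Z).
  by have := SB _ _ Skq (circle_graphMz (k %/ n)%Z GS' Sq0); rewrite pairMz.
have nz : n%:Z != 0 by rewrite eqz_nat -lt0n.
have kE : (k %% n)%Z = k - n%:Z * (k %/ n)%Z.
  by rewrite {2}(divz_eq k n) mulrC addrAC subrr add0r.
have [m mE] : exists m : nat, (k %% n)%Z = m.
  by exists `|(k %% n)%Z|%N; rewrite gez0_abs ?modz_ge0.
have mn : (m < n)%N by rewrite -ltz_nat -mE ltz_pmod.
rewrite -mulrzA -mulrzBr -kE mE in Sr.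
have m0 : m = 0%N.
  apply/eqP; apply: contraTT mn => m0; rewrite -leqNgt; apply: minn.
  by rewrite /D lt0n m0; apply/asboolP; eexists; apply: Sr.
have -> : q0 / n%:R *~ k = q0 *~ (k %/ n)%Z.
  have kE' : k = n%:Z * (k %/ n)%Z by apply/eqP; rewrite -subr_eq0 -kE mE m0.
  by rewrite {1}kE' mulrzA -(mulrzr _ n) divfK // pnatr_eq0 -lt0n.
by apply: Sint; move: Sr; rewrite m0.
Qed.

(** Values of [S] at one point differ by integers, so the fractional part of a chosen value
    represents them all. *)
Lemma circle_graph_fun S : circle_graph S -> (forall x, exists r, S (x, r)) ->
  exists f : V -> rat, [/\ forall x, 0 <= f x < 1,
    forall x y, f x + f y - f (x + y) \is a Num.int
  & forall x r, S (x, r) -> r - f x \is a Num.int].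
Proof.
move=> [_ SB Sint] totS; have [g gS] := choice totS.
have gE x r : S (x, r) -> r - g x \is a Num.int.
  by move=> Sxr; have : S (x - x, r - g x) := SB _ _ Sxr (gS x); rewrite subrr => /Sint.
exists (fun x => g x - (Num.floor (g x))%:~R); split=> [x|x y|x r /gE xr].
- by rewrite subr_ge0 floor_le ltrBlDl -[1]/(1%:~R) -intrD floorD1_gt.
- have : S (x + y - y, g (x + y) - g y) := SB _ _ (gS _) (gS y).
  rewrite addrK => /gE xy.
  have -> (a b c : rat) (i j k : int) : a - i%:~R + (b - j%:~R) - (c - k%:~R) =
      (k - i - j)%:~R - (c - b - a) by rewrite !intrB; ring.
  by rewrite rpredB ?intr_int.
- by rewrite opprB addrCA rpredD ?intr_int.
Qed.
End CircleGraph.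

(** * A cone deciding the sign of non-torsion elements *)

Lemma nontorsion_cone (V : zmodType) : exists P : set V,
  [/\ ~ P 0, forall x y, P x -> P y -> P (x + y)
    & forall x, (forall n, (0 < n)%N -> x *+ n != 0) -> P x \/ P (- x)].
Proof.
pose Q (P : set V) := ~ P 0 /\ forall x y, P x -> P y -> P (x + y).
have Q0 : Q set0 by split=> [|x y] [].
have [F [X0 FX0] FQ totF|P [_ [P0 PD] maxP]] := Zorn_bigcup_above Q0.
  split=> [[X /FQ[]]//|x y [X FX Xx] [Y FY Yy]].
  have [_ XD] := FQ _ FX; have [_ YD] := FQ _ FY.
  have [XY|YX] := totF _ _ FX FY.
    by exists Y => //; apply: YD => //; apply: XY.
  by exists X => //; apply: XD => //; apply: YX.
exists P; split=> //.
have PM x n : P x -> (0 < n)%N -> P (x *+ n).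
  move=> Px; elim: n => // -[|n] IH _ //.
  by rewrite mulrS; apply: PD => //; apply: IH.
(* By maximality, adjoining [x] must produce 0, which puts a positive multiple of [- x] in [P]. *)
have neg x : (forall n, (0 < n)%N -> x *+ n != 0) -> ~ P x ->
    exists2 n, (0 < n)%N & P (- x *+ n).
  move=> tx nPx; apply: contrapT => nN.
  (* The semigroup generated by [P] and [x]; the last clause excludes the empty sum. *)
  pose P' := [set y | exists n p, [/\ p = 0 \/ P p, y = p + x *+ n
                                   & P p \/ (0 < n)%N]].
  apply: nPx; apply: (maxP P'); last by exists 1%N, 0; rewrite add0r; split; auto.
    by move=> y Py; exists 0%N, y; rewrite addr0; split; auto.
  split=> [[n [p [pP E np]]]|y z [n [p [pP -> np]]] [m [q [qP -> mq]]]].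
    case: (posnP n) => [n0|n0].
      by move: np E; rewrite n0 addr0 => -[Pp E|//]; rewrite -E in Pp.
    case: pP => [p0|Pp]; first by move/eqP: E; rewrite p0 add0r eq_sym (negPf (tx _ n0)).
    apply: nN; exists n => //; rewrite mulNrn.
    by move/eqP: E; rewrite eq_sym addr_eq0 => /eqP <-.
  exists (n + m)%N, (p + q); rewrite mulrnDr addrACA; split=> //.
    case: pP qP => [->|Pp] [->|Pq]; rewrite ?add0r ?addr0;
      by [left|right|right; apply: PD].
  rewrite addn_gt0; case: np mq => [Pp|->] [Pq|->]; rewrite ?orbT; try by right.
  by left; apply: PD.
move=> x tx; apply: contrapT => /not_orP[nPx nPNx].
(* Otherwise [P] contains opposite multiples of [x], whose sum is 0. *)
have [n n0 Pn] := neg _ tx nPx.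
have [|m m0 Pm] := neg _ _ nPNx.
  by move=> n' /tx; rewrite mulNrn oppr_eq0.
have := PD _ _ (PM _ m Pn m0) (PM _ n Pm n0).
by rewrite -!mulrnA opprK mulNrn mulnC addNr.
Qed.

(** * Rotation numbers of torsion elements *)

Section TorsionRotation.
Variables (V : zmodType) (phi : V -> V -> V -> int).
Hypothesis phi_range : forall x y z, phi x y z \in [:: -1; 0; 1].
Hypothesis phi_DV : forall x y z, phi x y z = 0 <-> [\/ x = y, y = z | x = z].
Hypothesis phi_C : forall g0 g1 g2 g3,
  phi g1 g2 g3 - phi g0 g2 g3 + phi g0 g1 g3 - phi g0 g1 g2 = 0.
Hypothesis phi_H : forall g x y z, phi (g + x) (g + y) (g + z) = phi x y z.
Implicit Types (x y z : V) (n : nat).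

Lemma natr_sum_ord n (c : rat) : n%:R * c = \sum_(i < n) c.
Proof. by rewrite sumr_const card_ord mulr_natl. Qed.

Lemma sum_shift (F : V -> rat) x n : x *+ n = 0 ->
  \sum_(i < n) F (x *+ i + x) = \sum_(i < n) F (x *+ i).
Proof.
move=> xn; apply: (addrI (F (x *+ 0))).
have -> : F (x *+ 0) + \sum_(i < n) F (x *+ i + x) = \sum_(i < n.+1) F (x *+ i).
  by rewrite big_ord_recl; congr (_ + _); apply: eq_bigr => i _; rewrite -mulrSr.
by rewrite big_ord_recr /= xn addrC.
Qed.

(** Inhomogeneous form of the cocycle [phi], scaled so that its primitive is the rotation number
    modulo 1, up to the correction in [theta_int]. *)
Definition theta x y : rat := - (phi 0 x (x + y))%:~R / 2.

Lemma theta_cocycle x y z :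
  theta y z + theta x (y + z) = theta x y + theta (x + y) z.
Proof.
have := phi_C 0 x (x + y) (x + (y + z)).
have := phi_H x 0 y (y + z); rewrite addr0 => ->.
rewrite /theta addrA => /(congr1 (intr : int -> rat)).
rewrite !(intrD, intrN) => E; lra.
Qed.

Definition total_theta n x : rat := \sum_(i < n) theta x (x *+ i).

(** By the cocycle identity, moving the base point by [z] changes the sum by differences that
    telescope around the closed orbit of [x]. *)
Lemma total_thetaE n x z : x *+ n = 0 ->
  \sum_(i < n) theta x (x *+ i + z) = total_theta n x.
Proof.
move=> xn; have E (i : 'I_n) : theta x (x *+ i + z) =
    theta x (x *+ i) + (theta (x *+ i + x) z - theta (x *+ i) z).
  by rewrite [_ + x]addrC; have := theta_cocycle x (x *+ i) z; lra.
rewrite (eq_bigr _ (fun i _ => E i)) big_split /= sumrB.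
by rewrite (sum_shift (theta^~ z)) // subrr addr0.
Qed.

Lemma total_thetaM n k x : x *+ n = 0 ->
  total_theta (k * n) x = k%:R * total_theta n x.
Proof.
move=> xn; elim: k => [|k IH]; first by rewrite mul0r [LHS]big_ord0.
rewrite [LHS]/total_theta mulSnr big_split_ord /= -[X in X + _]/(total_theta _ x) IH.
rewrite -natr1 mulrDl mul1r; congr (_ + _); apply: eq_bigr => i _.
by rewrite mulrnDr mulnC mulrnA xn mul0rn add0r.
Qed.

(** After division by [n], [total_theta n] is a primitive of [theta]: summing the cocycle identity
    over all [w i j] turns its terms into orbit sums. *)
Lemma total_thetaD n x y : (0 < n)%N -> x *+ n = 0 -> y *+ n = 0 ->
  total_theta n x + total_theta n y =
  n%:R * theta x y + total_theta n (x + y).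
Proof.
move=> n0 xn yn.
have nn0 : n%:R != 0 :> rat by rewrite pnatr_eq0 -lt0n.
pose w (i j : 'I_n) : V := x *+ i + y *+ j.
have shift (F : V -> rat) k :
    \sum_i \sum_j F ((x + y) *+ k + w i j) = \sum_i \sum_j F (w i j).
  elim: k => [|k <-].
    by apply: eq_bigr => i _; apply: eq_bigr => j _; rewrite mulr0n add0r.
  pose F' u := \sum_(j < n) F ((x + y) *+ k + (u + y *+ j)).
  rewrite -[RHS](sum_shift F') //; apply: eq_bigr => i _.
  pose F'' u := F ((x + y) *+ k + (x *+ i + x + u)).
  rewrite -[RHS](sum_shift F'') //; apply: eq_bigr => j _.
  congr F; rewrite mulrSr -addrA; congr (_ + _).
  by rewrite addrACA [x + _]addrC [y + _]addrC.
have Ex : \sum_i \sum_j theta x (y + w i j) = n%:R * total_theta n x.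
  rewrite exchange_big /= [RHS]natr_sum_ord.
  apply: eq_bigr => j _; rewrite -(total_thetaE (y + y *+ j) xn).
  by apply: eq_bigr => i _; rewrite /w addrCA.
have Ey : \sum_i \sum_j theta y (w i j) = n%:R * total_theta n y.
  rewrite natr_sum_ord.
  apply: eq_bigr => i _; rewrite -(total_thetaE (x *+ i) yn).
  by apply: eq_bigr => j _; rewrite /w addrC.
(* The points [w i j] are not grouped into orbits of [x + y]; summing over [n] shifts by its
   multiples creates such orbits, at the cost of a factor [n]. *)
have Exy : \sum_i \sum_j theta (x + y) (w i j) = n%:R * total_theta n (x + y).
  apply: (mulfI nn0); rewrite [LHS]natr_sum_ord.
  rewrite -(eq_bigr _ (fun k _ => shift (theta (x + y)) (nat_of_ord k))).
  rewrite exchange_big /= [RHS]natr_sum_ord.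
  apply: eq_bigr => i _.
  rewrite exchange_big /= [RHS]natr_sum_ord.
  apply: eq_bigr => j _; apply: total_thetaE.
  by rewrite mulrnDl xn yn addr0.
apply: (mulfI nn0); rewrite mulrDr -Ex -Ey mulrDr -Exy.
rewrite (natr_sum_ord n (_ * _)) -!big_split /=.
apply: eq_bigr => i _.
rewrite [in RHS]natr_sum_ord -!big_split /=.
by apply: eq_bigr => j _; rewrite addrC theta_cocycle.
Qed.

(** The added coboundary is 1/2 when 0, [x], [x + y] are distinct and an integer otherwise, which
    matches the parity of [phi]. *)
Lemma theta_int x y :
  theta x y + 1 / 2 + ((x == 0)%:R + (y == 0)%:R - (x + y == 0)%:R) / 2
  \is a Num.int.
Proof.
have int_eq (q : rat) (k : int) : q = k%:~R -> q \is a Num.int.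
  by move=> ->; apply: intr_int.
rewrite /theta; have := phi_DV 0 x (x + y); have := phi_range 0 x (x + y).
have [->|x0] := eqVneq x 0.
  move=> _ [_ ->]; last by constructor 1.
  by rewrite !add0r addrK; apply: (int_eq _ 1) => /=; field.
have [->|y0] := eqVneq y 0.
  move=> _ [_ ->]; last by constructor 2; rewrite addr0.
  by rewrite !addr0 (negPf x0); apply: (int_eq _ 1) => /=; field.
have [xy|xy] := eqVneq (x + y) 0.
  move=> _ [_ ->]; last by constructor 3.
  by apply: (int_eq _ 0) => /=; field.
rewrite !inE => /or3P[]/eqP-> [E _].
- by apply: (int_eq _ 1) => /=; field.
- have [] := E erefl; last by move/esym/eqP; rewrite (negPf xy).
    by move/esym/eqP; rewrite (negPf x0).
  by rewrite -{1}[x]addr0 => /addrI/esym/eqP; rewrite (negPf y0).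
- by apply: (int_eq _ 0) => /=; field.
Qed.

(** Each term is at most 1/2 in absolute value, and the vanishing term at [i = 0] makes the bound
    strict. *)
Lemma total_theta_bound n x : (0 < n)%N -> x *+ n = 0 ->
  `|total_theta n x| < n%:R / 2.
Proof.
move=> n0 xn.
have le_theta y : `|theta x y| <= 1 / 2.
  rewrite /theta normrM normrN (ger0_norm (_ : 0 <= 2^-1)) //.
  apply: ler_wpM2r => //.
  by have := phi_range 0 x (x + y); rewrite !inE => /or3P[]/eqP->.
case: n n0 xn => // n _ xn.
rewrite /total_theta big_ord_recl.
have -> : theta x (x *+ 0) = 0.
  rewrite /theta addr0 (phi_DV _ _ _).2 ?oppr0 ?mul0r //; exact: Or32.
rewrite add0r; apply: le_lt_trans (ler_norm_sum _ _ _) _.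
apply: (@le_lt_trans _ _ (n%:R / 2)); last by rewrite ltr_pM2r // ltr_nat.
rewrite mulrC -[2^-1]mul1r mulrC natr_sum_ord; exact: ler_sum.
Qed.

Lemma total_theta0 n : total_theta n 0 = 0.
Proof.
apply: big1 => i _; rewrite /theta mul0rn addr0.
by rewrite (phi_DV 0 0 0).2 ?oppr0 ?mul0r //; constructor 1.
Qed.

(* The last two terms make the coboundary integral: [phi] is odd exactly on the
   triples of distinct points. *)
Definition torsion_rotation n x : rat :=
  total_theta n x / n%:R + 1 / 2 + (x == 0)%:R / 2.

Definition rotation_graph : set (V * rat) := [set u | exists n,
  [/\ (0 < n)%N, u.1 *+ n = 0 & u.2 - torsion_rotation n u.1 \is a Num.int]].

Lemma torsion_rotationM n k x : (0 < n)%N -> (0 < k)%N -> x *+ n = 0 ->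
  torsion_rotation (k * n) x = torsion_rotation n x.
Proof.
move=> n0 k0 xn; rewrite /torsion_rotation total_thetaM // natrM.
by field; rewrite !pnatr_eq0 -!lt0n n0.
Qed.

(** At a common exponent, [total_thetaD] and [theta_int] make the coboundary of [torsion_rotation]
    integral. *)
Lemma rotation_graphP : circle_graph rotation_graph.
Proof.
split.
- exists 1%N; rewrite /torsion_rotation /= mulr1n total_theta0 eqxx.
  by split.
- move=> [x q] [y r] [n [/= n0 xn xq]] [m [/= m0 ym yr]]; exists (n * m)%N.
  have nm0 : (0 < n * m)%N by rewrite muln_gt0 n0.
  have xnm : x *+ (n * m) = 0 by rewrite mulrnA xn mul0rn.
  have ynm : y *+ (n * m) = 0 by rewrite mulnC mulrnA ym mul0rn.
  have dnm : (x - y) *+ (n * m) = 0 by rewrite mulrnBl xnm ynm subrr.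
  rewrite -(torsion_rotationM n0 m0 xn) mulnC in xq.
  rewrite -(torsion_rotationM m0 n0 ym) in yr.
  split=> //=.
  have := total_thetaD nm0 dnm ynm; have := theta_int (x - y) y; rewrite subrK.
  move: (n * m)%N xq yr nm0 {xnm ynm dnm} => N xq yr nm0.
  have N0 : N%:R != 0 :> rat by rewrite pnatr_eq0 -lt0n.
  set t := theta _ _ => tint tE.
  have := rpredB (rpredB xq yr) tint; congr (_ \is a Num.int).
  have {tE} -> : t = (total_theta N (x - y) + total_theta N y - total_theta N x) / N%:R.
    by rewrite tE; field.
  by rewrite /torsion_rotation; field.
- move=> q [n [/= n0 _]]; rewrite /torsion_rotation eqxx total_theta0 => qi.
  have := rpredD qi (int_num1 rat); congr (_ \is a Num.int).
  by rewrite mul0r /=; field.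
Qed.

Lemma rotation_graph_torsion x n : (0 < n)%N -> x *+ n = 0 ->
  exists q, rotation_graph (x, q).
Proof.
by move=> n0 xn; exists (torsion_rotation n x), n; rewrite /= subrr.
Qed.

Lemma rotation_graph_dom x q : rotation_graph (x, q) ->
  exists2 n, (0 < n)%N & x *+ n = 0.
Proof. by case=> n [n0 xn _]; exists n. Qed.

(** For [x] nonzero, the strict bound puts [torsion_rotation n x] strictly between 0 and 1. *)
Lemma rotation_graph_inj x q : rotation_graph (x, q) -> q \is a Num.int -> x = 0.
Proof.
case=> n [/= n0 xn xq] qi; apply/eqP/contraT => x0.
have := rpredB qi xq; rewrite opprB addrC subrK /torsion_rotation (negPf x0) mul0r addr0.
move=> /intrP[k kE].
have := total_theta_bound n0 xn; rewrite ltr_norml.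
have n0' : 0 < n%:R :> rat by rewrite ltr0n.
have -> : total_theta n x = (k%:~R - 1 / 2) * n%:R.
  by rewrite -kE; field; apply: lt0r_neq0.
move=> /andP[k1 k2].
have k0 : 0 < (k%:~R : rat) by nra.
have : (k%:~R : rat) < 1 by nra.
by move: k0; rewrite ltr0z ltrz1; lia.
Qed.
End TorsionRotation.

(** * Orders wound around the circle *)

Section WoundOrders.
Variable G : groupType.
Implicit Types (f : G -> rat) (lt : rel G).

Definition sgo lt x y : rat := (lt x y)%:R - (lt y x)%:R.

(* [wo_left] expresses that [lt] is left invariant up to cyclic rotation: when [f]
   wraps around past 1 at exactly one of [g * x] and [g * y], the comparison
   is reversed. *)
Record wound f lt : Prop := Wound {
  wo_irr : irreflexive lt;
  wo_trans : transitive lt;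
  wo_total : forall x y, x != y -> lt x y || lt y x;
  wo_f1 : f 1%g = 0;
  wo_f01 : forall x, 0 <= f x < 1;
  wo_left : forall g x y, sgo lt (g * x)%g (g * y)%g + 2 * (f (g * x)%g - f (g * y)%g)
                          = sgo lt x y + 2 * (f x - f y) }.

Lemma sgoN lt x y : sgo lt y x = - sgo lt x y.
Proof. by rewrite /sgo opprB. Qed.

Section StrictTotal.
Variable lt : rel G.
Hypotheses (lt_irr : irreflexive lt) (lt_trans : transitive lt)
  (lt_total : forall x y, x != y -> lt x y || lt y x).

Lemma lt_trichotomy x y :
  [\/ x = y, lt x y /\ lt y x = false | lt y x /\ lt x y = false].
Proof.
have asym u v : lt u v -> lt v u = false.
  by move=> uv; apply/negP => /(lt_trans uv); rewrite lt_irr.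
have [->|/lt_total/orP[xy|yx]] := eqVneq x y; first by constructor 1.
  by constructor 2; rewrite xy asym.
by constructor 3; rewrite yx asym.
Qed.

(** Pairwise signs reduce the cocycle identity and invariance to linear arithmetic over Q. *)
Lemma circular_of_linear_sgo x y z :
  (circular_of_linear lt x y z)%:~R = sgo lt x y + sgo lt y z + sgo lt z x.
Proof.
rewrite /sgo /circular_of_linear.
have [->|[xy yx]|[yx xy]] := lt_trichotomy x y.
- by rewrite lt_irr; have [->|[-> ->]|[-> ->]] := lt_trichotomy y z; rewrite ?lt_irr.
- have [<-|[yz zy]|[zy yz]] := lt_trichotomy y z; first by rewrite lt_irr xy yx.
    have xz := lt_trans xy yz; have [E|[_ zx]|[zx _]] := lt_trichotomy x z.
    + by rewrite E lt_irr in xz.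
    + by rewrite xy yx yz zy xz zx.
    + by have := lt_trans xz zx; rewrite lt_irr.
  by have [->|[-> ->]|[-> ->]] := lt_trichotomy x z; rewrite ?lt_irr ?xy ?yx ?yz ?zy.
- have [<-|[yz zy]|[zy yz]] := lt_trichotomy y z; first by rewrite lt_irr xy yx.
    by have [->|[-> ->]|[-> ->]] := lt_trichotomy x z; rewrite ?lt_irr ?xy ?yx ?yz ?zy.
  have zx := lt_trans zy yx; have [E|[xz _]|[_ xz]] := lt_trichotomy x z.
  + by rewrite E lt_irr in zx.
  + by have := lt_trans xz zx; rewrite lt_irr.
  + by rewrite xy yx yz zy xz zx.
Qed.

End StrictTotal.

Lemma wound_circular_order f lt :
  wound f lt -> circular_order (circular_of_linear lt).
Proof.
case=> I T O f1 f01 L; have E := circular_of_linear_sgo I T O.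
have inj : injective (intr : int -> rat) := @intr_inj _.
split=> [x y z|x y z|g0 g1 g2 g3|g x y z].
- by rewrite /circular_of_linear; do 2?case: ifP.
- split=> [/(congr1 (intr : int -> rat))|].
    rewrite E /sgo; have tri := lt_trichotomy I T O.
    have [xy|[-> ->]|[-> ->]] := tri x y; first by constructor 1.
      have [yz|[-> ->]|[-> ->]] := tri y z; first by constructor 2.
        by have [xz|[-> ->]|[-> ->]] := tri x z; first by constructor 3.
      by have [xz|[-> ->]|[-> ->]] := tri x z; first by constructor 3.
    have [yz|[-> ->]|[-> ->]] := tri y z; first by constructor 2.
      by have [xz|[-> ->]|[-> ->]] := tri x z; first by constructor 3.
    by have [xz|[-> ->]|[-> ->]] := tri x z; first by constructor 3.
  move=> H; apply: inj; rewrite E /sgo.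
  by case: H => ->; rewrite I; ring.
- apply: inj; rewrite !(intrD, intrN) !E.
  by rewrite (sgoN _ g1 g3) (sgoN _ g0 g3) (sgoN _ g0 g2); ring.
(* Around the triangle, the [f] terms of [wo_left] cancel. *)
- apply: inj; rewrite !E.
  by have := L g x y; have := L g y z; have := L g z x; lra.
Qed.

(** Linear orders are the case without winding, so [wound_uniq] can test genuineness. *)
Lemma wound_linear lt : left_linear_order lt -> wound (fun=> 0) lt.
Proof.
case=> I T O L; split=> // g x y; congr (_ + _); rewrite /sgo.
have E a b : lt (g * a)%g (g * b)%g = lt a b.
  apply/idP/idP => [/(L g^-1%g)|/(L g)//].
  by rewrite !mulKg.
by rewrite !E.
Qed.

(* [sgo lt 1 x - 2 f x] is a bounded function whose coboundary is the circular
   order, and there are no nonzero bounded homomorphisms to Q. *)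
Lemma wound_uniq f f' lt lt' : wound f lt -> wound f' lt' ->
  circular_of_linear lt = circular_of_linear lt' -> f =1 f'.
Proof.
move=> W W' cE.
pose h f lt (x : G) : rat := sgo lt 1%g x - 2 * f x.
have hE f0 lt0 x y : wound f0 lt0 ->
  (circular_of_linear lt0 1%g x (x * y)%g)%:~R =
    h f0 lt0 x + h f0 lt0 y - h f0 lt0 (x * y)%g.
  case=> I T O f1 f01 L; rewrite circular_of_linear_sgo // /h.
  have := L x 1%g y; rewrite mulg1 f1 (sgoN _ 1%g (x * y)%g); lra.
pose d x := h f lt x - h f' lt' x.
have dD x y : d (x * y)%g = d x + d y.
  by have := hE _ _ x y W; have := hE _ _ x y W'; rewrite cE /d; lra.
have dX x n : d (x ^+ n)%g = n%:R * d x.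
  elim: n => [|n IH]; last by rewrite expgS dD IH -[n.+1%:R]natr1; ring.
  by apply: (addrI (d 1%g)); rewrite expg0 -dD mulg1; ring.
have sg_bound lt0 x y : -1 <= sgo lt0 x y <= 1.
  by rewrite /sgo; case: (lt0 x y); case: (lt0 y x).
(* Each [h] takes values between -3 and 1. *)
have d_bound x : -4 <= d x <= 4.
  have := wo_f01 W x; have := wo_f01 W' x.
  have := sg_bound lt 1%g x; have := sg_bound lt' 1%g x; rewrite /d /h; lra.
have d0 x : d x = 0.
  apply/eqP/contraT => dx.
  pose n := Num.bound (4 / `|d x|).
  have := archi_boundP (_ : 0 <= 4 / `|d x|).
  rewrite divr_ge0 // => /(_ isT); rewrite ltr_pdivrMr ?normr_gt0 // -/n => n4.
  have := d_bound (x ^+ n)%g; rewrite -ler_norml dX normrM normr_nat.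
  by rewrite leNgt n4.
(* Now [2 * (f x - f' x)] is a difference of two signs, so 0, 2 or -2; since both values lie in [0,
   1), it is 0. *)
move=> x; have [->|x1] := eqVneq x 1%g; first by rewrite (wo_f1 W) (wo_f1 W').
have := d0 x; have /andP[f0 fl] := wo_f01 W x; have /andP[f0' fl'] := wo_f01 W' x.
rewrite /d /h /sgo; rewrite eq_sym in x1.
have tri := lt_trichotomy (wo_irr W) (@wo_trans _ _ W) (wo_total W) 1%g x.
have tri' := lt_trichotomy (wo_irr W') (@wo_trans _ _ W') (wo_total W') 1%g x.
have [E|[-> ->]|[-> ->]] := tri; first by rewrite E eqxx in x1.
  have [E|[-> ->]|[-> ->]] := tri'; [by rewrite E eqxx in x1| |]; rewrite /=; lra.
have [E|[-> ->]|[-> ->]] := tri'; [by rewrite E eqxx in x1| |]; rewrite /=; lra.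
Qed.

Lemma wound_genuine f lt b : wound f lt -> f b != 0 ->
  COg (circular_of_linear lt).
Proof.
move=> W fb; split; first exact: wound_circular_order W.
move=> [lt' /wound_linear W' E].
by rewrite (wound_uniq W W' E) eqxx in fb.
Qed.

Lemma wound_autom (rho : autom G) f lt : wound f lt ->
  wound (fun x => f (rho x)) (fun x y => lt (rho x) (rho y)).
Proof.
case=> I T O f1 f01 L; split=> [x|y x z|x y xy||x|g x y].
- exact: I.
- exact: T.
- by apply: O; rewrite (can_eq (@automK _ rho)).
- have := automM rho 1%g 1%g; rewrite mulg1 => E.
  suff -> : rho 1%g = 1%g by [].
  by apply: (mulgI (rho 1%g)); rewrite -E mulg1.
- exact: f01.
- by rewrite /sgo !automM; exact: L.
Qed.

(** The pullback of [lt] along [rho] induces the same circular order but is wound by [f] after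
    [rho]; uniqueness equates the two windings. *)
Lemma wound_autom_fix (rho : autom G) f lt : wound f lt ->
  autom_act rho (circular_of_linear lt) = circular_of_linear lt ->
  forall x, f (rho x) = f x.
Proof.
move=> W E x; rewrite -(wound_uniq W (wound_autom rho W)) //.
apply/funext => u; apply/funext => v; apply/funext => w.
have /(congr1 (fun c => c (rho u) (rho v) (rho w))) := E.
have K y : (rho^-1)%g (rho y) = y by apply: automK.
by rewrite /autom_act !K.
Qed.

Lemma wound_of_cone f (P : set G) : (forall x, 0 <= f x < 1) ->
  (forall x y, f x + f y - f (x * y)%g \is a Num.int) ->
  ~ P 1%g -> (forall x y, P x -> P y -> P (x * y)%g) ->
  (forall x, f x = 0 -> x <> 1%g -> P x \/ P (x^-1)%g) ->
  exists lt, wound f lt.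
Proof.
move=> f01 fD P1 PM Ptot.
(* The integer is the carry of addition modulo 1. *)
have fM x y : f x + f y - f (x * y)%g = (1 <= f x + f y)%R%:R.
  have /intrP[k kE] := fD x y; rewrite kE.
  have := f01 x; have := f01 y; have := f01 (x * y)%g.
  move=> /andP[a1 a2] /andP[b1 b2] /andP[c1 c2].
  have k1 : (k%:~R : rat) < 2%:~R by rewrite -kE; lra.
  have k2 : (-1)%:~R < (k%:~R : rat) by rewrite -kE; lra.
  rewrite !ltr_int in k1 k2.
  have [k0|k0] : k = 0 \/ k = 1 by lia.
    by rewrite k0; case: leP => //=; move: kE; rewrite k0 => *; lra.
  by rewrite k0; case: leP => //=; move: kE; rewrite k0 => *; lra.
pose lt x y := (f x < f y) || (f x == f y) && `[< P (x^-1 * y)%g >].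
have f1 : f 1%g = 0.
  have := fM 1%g 1%g; rewrite mulg1 addrK; have := f01 1%g.
  by case: (leP 1 (_ + _)) => //=; lra.
have fV x y : f x = f y -> f (x^-1 * y)%g = 0.
  move=> xy; have := fM x (x^-1 * y)%g; rewrite mulVKg xy; have := f01 (x^-1 * y)%g.
  by case: (leP 1 (_ + _)) => /= _; lra.
(* With equal carries both values of [f] shift equally, and the element tested by the cone is
   unchanged. *)
have ltM g x y : (1 <= f g + f x) = (1 <= f g + f y) ->
    lt (g * x)%g (g * y)%g = lt x y.
  move=> s; have := fM g x; have := fM g y; rewrite s => fy fx.
  have E : f (g * x)%g - f x = f (g * y)%g - f y by lra.
  rewrite /lt (_ : (g * x)^-1 * (g * y) = x^-1 * y)%g; last first.
    by rewrite invgM -mulgA mulKg.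
  have -> : (f (g * x)%g < f (g * y)%g) = (f x < f y).
    by apply/idP/idP => ?; lra.
  by have -> : (f (g * x)%g == f (g * y)%g) = (f x == f y) by apply/eqP/eqP => ?; lra.
have ltf x y : f x < f y -> lt x y /\ lt y x = false.
  by move=> xy; rewrite /lt xy; split=> //; rewrite ltNge (ltW xy) gt_eqF.
(* If only [y] wraps, it is ahead of [x] before translation and behind it afterwards. *)
have cross g x y : f g + f x < 1 -> 1 <= f g + f y ->
    [/\ lt x y, lt y x = false, lt (g * y)%g (g * x)%g & lt (g * x)%g (g * y)%g = false].
  move=> gx gy; have [|-> ->] := ltf x y; first by lra.
  have [|-> ->] := ltf (g * y)%g (g * x)%g; last by [].
  have := fM g x; have := fM g y; rewrite gy leNgt gx /=.
  by have := f01 x; have := f01 y; lra.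
exists lt; split=> //.
- by move=> x; rewrite /lt ltxx eqxx mulVg /=; apply/asboolP.
- move=> y x z; rewrite /lt => /orP[xy|/andP[/eqP-> /asboolP xy]].
    by move=> /orP[yz|/andP[/eqP<- _]]; [rewrite (lt_trans xy yz)|rewrite xy].
  move=> /orP[->//|/andP[-> /asboolP yz]]; apply/orP; right; apply/asboolP.
  by have := PM _ _ xy yz; rewrite -mulgA mulVKg.
- move=> x y xy; rewrite /lt; case: ltgtP => //= fxy.
  have [||P1'|P2'] := Ptot (x^-1 * y)%g.
  + exact: fV.
  + move=> E; move/eqP: xy; apply.
    by rewrite -[y](mulVKg x) E mulg1.
  + by apply/orP; left; apply/asboolP.
  + by apply/orP; right; apply/asboolP; move: P2'; rewrite invgM invgK.
- move=> g x y; have := fM g x; have := fM g y; rewrite /sgo.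
  case: (leP 1 (f g + f x)) (ltM g x y) (cross g x y) (ltM g y x) (cross g y x) => gx.
    case: (leP 1 (f g + f y)) => gy E1 _ E2 C.
      by rewrite E1 // E2 //=; lra.
    by have [//|//|-> -> -> ->] := C; rewrite /=; lra.
  case: (leP 1 (f g + f y)) => gy E1 C E2 _.
    by have [//|//|-> -> -> ->] := C; rewrite /=; lra.
  by rewrite E1 // E2 //=; lra.
Qed.
End WoundOrders.

(** * A homomorphism to Q/Z separating [b] from 0 *)

Lemma exists_separating_rotation (V : zmodType) (phi : V -> V -> V -> int) (b : V) :
  (forall x y z, phi x y z \in [:: -1; 0; 1]) ->
  (forall x y z, phi x y z = 0 <-> [\/ x = y, y = z | x = z]) ->
  (forall g0 g1 g2 g3,
     phi g1 g2 g3 - phi g0 g2 g3 + phi g0 g1 g3 - phi g0 g1 g2 = 0) ->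
  (forall g x y z, phi (g + x) (g + y) (g + z) = phi x y z) ->
  b != 0 ->
  exists f : V -> rat, [/\ forall x, 0 <= f x < 1,
    forall x y, f x + f y - f (x + y) \is a Num.int, f b != 0
  & forall x n, (0 < n)%N -> x *+ n = 0 -> f x = 0 -> x = 0].
Proof.
move=> R D C H b0; pose S0 := rotation_graph phi.
have GS0 : circle_graph S0 := rotation_graphP R D C H.
have [S [S0S GS Sb]] : exists S, [/\ S0 `<=` S, circle_graph S
    & exists q, S (b, q) /\ q \isn't a Num.int].
  have [[n [n0 bn]]|tb] := pselect (exists n, (0 < n)%N /\ b *+ n = 0).
    exists S0; split=> //; have [q bq] := rotation_graph_torsion phi n0 bn.
    exists q; split=> //; apply: contra b0 => qi.
    by rewrite (rotation_graph_inj R D bq qi).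
  (* Any non-integer value would do: a nonzero multiple of [b] in the torsion domain would make [b]
     torsion, so only [k = 0] is constrained. *)
  have [k q kq|S [S0S bS GS]] :=
      @circle_graph_adjoin _ S0 b (1 / 2) GS0.
    have [n n0 kn] := rotation_graph_dom kq.
    suff k0 : k = 0 by move: kq; rewrite k0 !mulr0z subr0; case: GS0 => _ _; apply.
    apply: contrapT => /eqP k0; apply: tb; exists (`|k| * n)%N.
    rewrite muln_gt0 absz_gt0 k0 n0 mulrnA; split=> //.
    by rewrite [b *+ _]pmulrn abszEsg mulrzA mulrzAC pmulrn mulrzAC -pmulrn kn mul0rz.
  by exists S; split=> //; exists (1 / 2).
have [S' [SS' GS' totS']] := circle_graph_total GS.
have [f [f01 fD fS']] := circle_graph_fun GS' totS'.
exists f; split=> //.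
  have [q [bq qi]] := Sb; apply: contra qi => /eqP fb.
  by have := fS' _ _ (SS' _ bq); rewrite fb subr0.
move=> x n n0 xn fx; have [q xq] := rotation_graph_torsion phi n0 xn.
apply: (rotation_graph_inj R D xq).
by have := fS' _ _ (SS' _ (S0S _ xq)); rewrite fx subr0.
Qed.

(** * Wound orders on abelian groups, and faithfulness *)

Section AdditiveNotation.
Variables (G : groupType) (hab : abelian_group G).

(* The [let] makes commutativity an argument of the alias: its zmodType structure
   needs it. *)
Definition additive_group : Type := let _ := hab in G.
HB.instance Definition _ := Choice.on additive_group.

Let add (x y : additive_group) : additive_group := (x * y)%g.
Let zero : additive_group := 1%g.
Let opp (x : additive_group) : additive_group := (x^-1)%g.

Let addA : associative add. Proof. exact: mulgA. Qed.
Let add0 : left_id zero add. Proof. exact: mul1g. Qed.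
Let addN : left_inverse zero opp add. Proof. exact: mulVg. Qed.

HB.instance Definition _ :=
  GRing.isZmodule.Build additive_group addA hab add0 addN.

Lemma exists_wound (phi : G -> G -> G -> int) (b : G) :
  circular_order phi -> b != 1%g ->
  exists f lt, [/\ wound f lt, f b != 0
    & forall x y, f x + f y - f (x * y)%g \is a Num.int].
Proof.
case=> R D C H b1.
have [f [f01 fD fb fker]] :=
  @exists_separating_rotation additive_group phi b R D C H b1.
have [P [P0 PD Ptot]] := nontorsion_cone additive_group.
have [x fx x1|lt W] := wound_of_cone f01 fD P0 PD; last by exists f, lt.
(* Torsion elements of the kernel are trivial, so the cone decides all the others. *)
by apply: Ptot => n n0; apply/eqP => xn; apply: x1; apply: fker n0 xn fx.
Qed.

End AdditiveNotation.

Theorem corollary3p11 (A : groupType)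
  (hfg : finitely_generated A) (hab : abelian_group A)
  (hco : circularly_orderable A) :
  acts_faithfully_on (@autom_act A) (@COg A).
Proof.
split; first exact: autom_acts_on_COg.
move=> rho fix_rho; apply: autom_eq => a.
have [phi CO_phi] := hco.
apply/eqP; apply/contraT => rho_a.
have [|f [lt [W fb fD]]] := @exists_wound A hab phi (a^-1 * rho a)%g CO_phi.
  by apply: contra rho_a => /eqP E; rewrite -[rho a](mulVKg a) E mulg1.
have frho : f (rho a) = f a.
  apply: (wound_autom_fix W); apply: fix_rho; exact: wound_genuine W fb.
(* Modulo 1 the value at [a^-1 * rho a] is [f (rho a) - f a], that is 0; lying in [0, 1), it would
   vanish, against [fb]. *)
have := fD a (a^-1 * rho a)%g; rewrite mulVKg frho addrAC subrr add0r => fi.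
have /andP[f0 f1] := wo_f01 W (a^-1 * rho a)%g.
by have := norm_intr_ge1 fi fb; rewrite ger0_norm // leNgt f1.
Qed.
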